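(* Let $\mathcal{M}=\langle S,N,V\rangle$ be a neighborhood model. For each $w\in S$ let $U_w=\{X\subseteq S\mid w\in X\}$ and let $\Sigma_w\subseteq U_w$ be an arbitrary subset. Define $\mathcal{M}^{u^+}=\langle S,N^{u^+},V\rangle$ and $\mathcal{M}^{u^-}=\langle S,N^{u^-},V\rangle$, where for each $w\in S$, $N^{u^+}(w)=N(w)\cup\Sigma_w$ and $N^{u^-}(w)=N(w)\setminus\Sigma_w$. Then for all $w\in S$ and all $\alpha\in\mathcal{L}(W)$, $$\mathcal{M},w\vDash\alpha\ \text{ iff }\ \mathcal{M}^{u^+},w\vDash\alpha$$ and $$\mathcal{M},w\vDash\alpha\ \text{ iff }\ \mathcal{M}^{u^-},w\vDash\alpha.$$
   Context: Fix a nonempty set $\mathbf{P}$ of propositional variables, $p\in\mathbf{P}$. $\mathcal{L}(W)$: $\varphi::=p\mid\neg\varphi\mid\varphi\land\varphi\mid W\varphi$. A neighborhood model is $\mathcal{M}=\langle S,N,V\rangle$ with $S$ a nonempty set, $N:S\to\mathcal{P}(\mathcal{P}(S))$, and $V:\mathbf{P}\to\mathcal{P}(S)$. With $\varphi^{\mathcal{M}}=\{s\in S\mid\mathcal{M},s\vDash\varphi\}$: $\mathcal{M},s\vDash p$ iff $s\in V(p)$; Boolean connectives as usual; $\mathcal{M},s\vDash W\varphi$ iff $\varphi^{\mathcal{M}}\in N(s)$ and $s\notin\varphi^{\mathcal{M}}$. *)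

(* Defs.v *)
From mathcomp Require Import all_boot.
From mathcomp Require Import classical_sets.

Set Implicit Arguments.
Unset Strict Implicit.
Unset Printing Implicit Defensive.

Local Open Scope classical_set_scope.

(** The language L(W), over a type [P] of propositional variables. *)
Inductive form (P : Type) : Type :=
| Var of P
| Neg of form P
| And of form P & form P
| Wrong of form P.

Record nmodel (P : Type) := NModel {
  world : Type;
  world_inh : inhabited world;
  nbhd : world -> set (set world);
  val : P -> set world
}.

Fixpoint sat (P : Type) (M : nmodel P) (s : world M) (phi : form P) : Prop :=
  match phi with
  | Var p => val p s
  | Neg psi => ~ sat s psi
  | And psi chi => sat s psi /\ sat s chi
  | Wrong psi =>
      (* [[set t | sat t psi]] is the truth set of [psi] in [M] *)
      nbhd s [set t : world M | sat t psi] /\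
      ~ [set t : world M | sat t psi] s
  end.

Definition sets_containing (S : Type) (w : S) : set (set S) :=
  [set X : set S | X w].

Definition model_plus (P : Type) (M : nmodel P)
    (Sigma : world M -> set (set (world M))) : nmodel P :=
  @NModel P (world M) (world_inh M)
    (fun w => nbhd w `|` Sigma w) (@val P M).

Definition model_minus (P : Type) (M : nmodel P)
    (Sigma : world M -> set (set (world M))) : nmodel P :=
  @NModel P (world M) (world_inh M)
    (fun w => nbhd w `\` Sigma w) (@val P M).

(* Main.v *)
(* [W phi] only queries [N w] at a set not containing [w], so satisfaction
   depends on [N] only through the members of [N w] that omit [w]. *)
Require Import Defs.
From mathcomp Require Import all_boot.
From mathcomp Require Import classical_sets.

Local Open Scope classical_set_scope.

(** Evaluating [Wrong] at [w] consults [nbhd w] only about truth sets omitting [w], while every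
    member of [Sigma w] contains [w]; adding or removing such sets is therefore invisible.
    [sat_eq_nbhd] isolates this by induction on formulas, and both halves of the theorem are
    instances of it. *)

Lemma sat_eq_nbhd (P : Type) (M : nmodel P)
    (N : world M -> set (set (world M))) :
  (forall w (X : set (world M)), ~ X w -> nbhd w X <-> N w X) ->
  forall (alpha : form P) (w : world M),
    sat w alpha <-> @sat P (NModel (world_inh M) N (@Defs.val P M)) w alpha.
Proof.
move=> eqN; elim=> [p|phi IH|phi IHphi psi IHpsi|phi IH] w /=.
- by [].
- by rewrite IH.
- by rewrite IHphi IHpsi.
- rewrite -IH.
  (* The induction hypothesis, used at all worlds, makes the two truth sets equal, so both
     neighborhood functions are queried at the same set. *)
  have <- : [set t : world M | sat t phi] =
      [set t | @sat P (NModel (world_inh M) N (@Defs.val P M)) t phi].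
    by apply/seteqP; split=> t /IH.
  by split=> -[NX Xw]; split=> //; apply/(eqN w [set t : world M | sat t phi] Xw).
Qed.

Theorem proposition4p10 (P : Type) (P_inh : inhabited P) (M : nmodel P)
    (Sigma : world M -> set (set (world M)))
    (Sigma_sub : forall w : world M, Sigma w `<=` sets_containing w) :
  forall (w : world M) (alpha : form P),
    (@sat P M w alpha <-> @sat P (model_plus Sigma) w alpha) /\
    (@sat P M w alpha <-> @sat P (model_minus Sigma) w alpha).
Proof.
move=> w alpha; split; apply: sat_eq_nbhd => v X Xv; split.
- by left.
- by case=> // /Sigma_sub.
- by move=> NX; split=> // /Sigma_sub.
- by case.
Qed.
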